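(* Let $K \ge 1$ be a real number and let $\{p_n\}_{n=1}^{\infty}$ be a sequence of positive integers such that $p_{n+1} \ge K p_n (p_n + 1)$ holds for all sufficiently large $n \in \mathbb{N}$. Let $l \in \{1, 2, \dots, [K]\}$, where $[K]$ is the integer part of $K$. Then \[ f(-l; \{p_n\}) = \sum_{n=1}^{\infty} \frac{(-1)^n}{p_n} l^n \] is an irrational number.
   Context: For such a sequence $\{p_n\}$, $f(z;\{p_n\}) = \sum_{n=1}^{\infty} z^n/p_n$ defines an entire function of $z$. *)

(* Defs.v *)
From HB Require Import structures.
From mathcomp Require Import all_boot all_order all_algebra.
From mathcomp Require Import all_classical all_reals all_analysis.
Import Order.TTheory GRing.Theory Num.Theory numFieldNormedType.Exports.

Set Implicit Arguments.
Unset Strict Implicit.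
Unset Printing Implicit Defensive.

Local Open Scope ring_scope.
Local Open Scope classical_set_scope.

(* Stated over any numFieldType so that both the complex function and its
   restriction to the reals are instances. [p 0] is never used. *)
Definition recip_series (F : numFieldType) (p : nat -> nat) (z : F) : F :=
  limn (fun N => \sum_(1 <= n < N) (z ^+ n / (p n)%:R)).

(* Main.v *)
Require Import Defs.
From HB Require Import structures.
From mathcomp Require Import all_boot all_order all_algebra.
From mathcomp Require Import all_classical all_reals all_analysis.
From mathcomp Require Import ring lra.
Import Order.TTheory GRing.Theory Num.Theory numFieldNormedType.Exports.
Local Open Scope ring_scope.
Local Open Scope classical_set_scope.

(** Let [s n] be the [n]-th tail of the series, divided by [(-l)^n], so that
    [s n = 1 / p n - l * s n.+1]. The growth condition gives
    [1 / (p n + 1) < s n < 1 / p n] for large [n]. If [s n = u / v], then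
    [s n.+1 = (v - u * p n) / (l * v * p n)], and these bounds say exactly that
    the new numerator satisfies [0 < v - u * p n < u]. A rational sum would
    therefore give an infinite descent on the numerators. *)

(** Induction on the number of terms: after the first term [c n], what remains is minus an
    alternating sum starting at [n.+1], which lies between [0] and [c n.+1 <= c n]. *)
Lemma alternating_sum_bounds (R : realDomainType) (c : nat -> R) (N : nat) :
  (forall k, (N <= k)%N -> 0 <= c k) ->
  (forall k, (N <= k)%N -> c k.+1 <= c k) ->
  forall m n, (N <= n)%N ->
    0 <= \sum_(i < m) (-1) ^+ i * c (n + i)%N <= c n.
Proof.
move=> c_ge0 c_dec; elim=> [|m IH] n Nn; first by rewrite big_ord0 lexx c_ge0.
rewrite big_ord_recl expr0 mul1r addn0.
have -> : \sum_(i < m) (-1) ^+ lift ord0 i * c (n + lift ord0 i)%N =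
    - \sum_(i < m) (-1) ^+ i * c (n.+1 + i)%N.
  rewrite -sumrN; apply: eq_bigr => i _.
  by rewrite /= /bump /= add1n exprS mulN1r mulNr addnS addSn.
have /andP[lo hi] := IH n.+1 (leqW Nn).
by have := c_dec n Nn; lra.
Qed.

(** Beyond [N] the terms are dominated by the geometric sequence [|u N| / 2 ^ n], so the series
    converges absolutely. *)
Lemma is_cvg_series_halving (R : realType) (u : R ^nat) (N : nat) :
  (forall k, (N <= k)%N -> `|u k.+1| <= `|u k| / 2) -> cvgn (series u).
Proof.
move=> halving.
rewrite -(is_cvg_series_restrict N).
suff /cvg_ex[x] : cvgn [sequence \sum_(N <= k < n + N) u k]_n.
  by rewrite (cvg_shiftn N (fun n => \sum_(N <= k < n) u k)) => /cvgP.
have -> : [sequence \sum_(N <= k < n + N) u k]_n = series (fun k => u (k + N)%N).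
  by apply/funext => n; rewrite seriesEnat /= -{1}[N]add0n big_addn addnK.
apply: normed_cvg.
apply: (@series_le_cvg _ _ (geometric `|u N| 2^-1)) => [n|n|n|] /=.
- exact: normr_ge0.
- by rewrite mulr_ge0 // exprn_ge0.
- elim: n => [|n IH]; first by rewrite expr0 mulr1.
  rewrite addSn exprSr mulrA (le_trans (halving _ (leq_addl _ _))) //.
  by rewrite ler_pM2r // invr_gt0.
- by apply: is_cvg_geometric_series; rewrite ger0_norm ?invf_lt1 ?ltr1n.
Qed.

(** The algebra behind the recurrence for [s], to be read with [e] the sign, [a] the power of [l],
    [b = p n] and [t] the undivided tail. *)
Lemma signed_tail_rec (F : fieldType) (a b e l t : F) :
  a != 0 -> b != 0 -> l != 0 -> e * e = 1 ->
  e * t / a = b^-1 - l * ((-1 * e) * (t - e * (a / b)) / (l * a)).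
Proof.
move=> a0 b0 l0 ee.
(* The relation [e * e = 1] is isolated in a vanishing term, so that what remains is a pure field
   identity. *)
transitivity (b^-1 * (1 - e * e) + e * t / a).
  by rewrite ee subrr mulr0 add0r.
by field; rewrite a0 b0 l0.
Qed.

Section Descent.
Context (R : realFieldType) (p : nat -> nat) (l N : nat) (s : nat -> R).
Hypothesis l_gt0 : (0 < l)%N.
Hypothesis p_gt0 : forall n, (N <= n)%N -> (0 < p n)%N.
Hypothesis p_growth : forall n, (N <= n)%N -> (l * (p n * (p n).+1) <= p n.+1)%N.
Hypothesis s_rec : forall n, (N <= n)%N -> s n = (p n)%:R^-1 - l%:R * s n.+1.
Hypothesis s_ge0 : forall n, (N <= n)%N -> 0 <= s n.

Let pR_gt0 n : (N <= n)%N -> 0 < (p n)%:R :> R.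
Proof. by move=> Nn; rewrite ltr0n p_gt0. Qed.

(** The growth condition is calibrated to the telescoping identity [1/x - 1/(x(x+1)) = 1/(x+1)] at
    [x = p n]. *)
Let inv_growth n : (N <= n)%N ->
  (p n).+1%:R^-1 <= (p n)%:R^-1 - l%:R / (p n.+1)%:R :> R.
Proof.
move=> Nn.
have a0 := pR_gt0 _ Nn; have b0 := pR_gt0 _ (leqW Nn).
have h : l%:R / (p n.+1)%:R <= ((p n)%:R * (p n).+1%:R)^-1 :> R.
  rewrite ler_pdivrMr // mulrC ler_pdivlMr ?mulr_gt0 ?ltr0n ?p_gt0 //.
  by rewrite -!natrM ler_nat p_growth.
suff <- : (p n)%:R^-1 - ((p n)%:R * (p n).+1%:R)^-1 = (p n).+1%:R^-1 :> R.
  by rewrite lerD2l lerN2.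
have p1_gt0 : 0 < (p n)%:R + 1 :> R by rewrite addr_gt0.
by rewrite -natr1; field; rewrite !gt_eqF.
Qed.

(** The bounds are bootstrapped through the recurrence: nonnegativity of [s n.+1] gives the weak
    upper bound, which one index later gives positivity, then the strict upper bound, and finally
    the strict lower bound. *)
Let s_le n : (N <= n)%N -> s n <= (p n)%:R^-1.
Proof. by move=> Nn; rewrite s_rec // gerBl mulr_ge0 // s_ge0 // leqW. Qed.

Let s_gt0 n : (N <= n)%N -> 0 < s n.
Proof.
move=> Nn; apply: (@lt_le_trans _ _ (p n).+1%:R^-1); first by rewrite invr_gt0 ltr0n.
rewrite (le_trans (inv_growth _ Nn)) // [leRHS]s_rec // lerD2l lerN2.
by rewrite ler_wpM2l // s_le // leqW.
Qed.

Let s_lt n : (N <= n)%N -> s n < (p n)%:R^-1.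
Proof. by move=> Nn; rewrite s_rec // gtrBl mulr_gt0 ?ltr0n // s_gt0 // leqW. Qed.

Let s_gt n : (N <= n)%N -> (p n).+1%:R^-1 < s n.
Proof.
move=> Nn; rewrite (le_lt_trans (inv_growth _ Nn)) // [ltRHS]s_rec //.
by rewrite ltrD2l ltrN2 ltr_pM2l ?ltr0n // s_lt // leqW.
Qed.

(** The fraction need not be reduced: only [u] has to decrease, while the denominator may grow
    freely. No base case is needed, since [u = 0] makes [gt_v] absurd. *)
Lemma numerator_descent (u v n : nat) :
  (N <= n)%N -> (0 < v)%N -> s n * v%:R <> u%:R.
Proof.
elim/ltn_ind: u v n => u IH v n Nn v0 suv.
have v0R : 0 < v%:R :> R by rewrite ltr0n.
have lt_v : (u * p n < v)%N.
  rewrite -(ltr_nat R) natrM -suv mulrAC -ltr_pdivlMr // divff ?gt_eqF //.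
  by rewrite -ltr_pdivlMr ?pR_gt0 // div1r s_lt.
(* This ensures that the natural subtraction [v - u * p n] is not truncated. *)
have le_v := ltnW lt_v.
have gt_v : (v < u * (p n).+1)%N.
  rewrite -(ltr_nat R) natrM -suv mulrAC -ltr_pdivrMr // divff ?gt_eqF //.
  by rewrite -ltr_pdivrMr ?ltr0n // div1r s_gt.
apply: (IH (v - u * p n)%N _ (l * v * p n)%N n.+1).
- by rewrite ltn_subLR // addnC -mulnS.
- exact: leqW.
- by rewrite !muln_gt0 l_gt0 v0 p_gt0.
- rewrite natrB // !natrM -suv [in RHS]s_rec //.
  by field; rewrite gt_eqF // pR_gt0.
Qed.

Lemma descent_irrational (n : nat) (q : rat) : (N <= n)%N -> s n <> ratr q.
Proof.
move=> Nn sq.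
have q_gt0 : 0 < q by rewrite -(ltr0q R) -sq s_gt0.
apply: (@numerator_descent `|numq q|%N `|denq q|%N n Nn).
  by rewrite absz_gt0 denq_neq0.
rewrite !natr_absz gtr0_norm ?denq_gt0 // gtr0_norm ?numq_gt0 // sq.
by rewrite /ratr divfK // intr_eq0 denq_neq0.
Qed.

End Descent.

Theorem theorem4p1 (R : realType) (K : R) (p : nat -> nat) (l : nat)
    (K_ge1 : 1 <= K)
    (p_gt0 : forall n : nat, (1 <= n)%N -> (0 < p n)%N)
    (p_growth : \forall n \near \oo,
       K * (p n)%:R * ((p n)%:R + 1) <= (p n.+1)%:R)
    (l_ge1 : (1 <= l)%N)
    (l_le : l%:Z <= Num.floor K) :
  (\sum_(1 <= n < N) ((-1) ^+ n / (p n)%:R * l%:R ^+ n) : R) @[N --> \oo]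
    --> recip_series p (- l%:R : R)
  /\ irrational (recip_series p (- l%:R : R)).
Proof.
pose c n : R := l%:R ^+ n / (p n)%:R.
pose u n : R := (-1) ^+ n * c n.
have uE n : (-1) ^+ n / (p n)%:R * l%:R ^+ n = u n by rewrite /u /c; ring.
have recipE : recip_series p (- l%:R : R) = limn (fun N => \sum_(1 <= n < N) u n).
  rewrite /recip_series; congr (limn _); apply/funext => M.
  by apply: eq_bigr => n _; rewrite exprNn /u /c mulrA.
rewrite recipE; under [X in X @ _ --> _]eq_fun do under eq_bigr do rewrite uE.
set L : R := limn _.
have lR_gt0 : 0 < l%:R :> R by rewrite ltr0n.
have [N0 _ growthN0] := p_growth.
pose N := maxn 1 N0.
have pN_gt0 n : (N <= n)%N -> (0 < p n)%N by rewrite geq_max => /andP[/p_gt0].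
have growth n : (N <= n)%N -> (l * (p n * (p n).+1) <= p n.+1)%N.
  rewrite geq_max => /andP[_ /growthN0 /= le_p].
  rewrite -(ler_nat R) (le_trans _ le_p) // !natrM -natr1 mulrA !ler_wpM2r // ?addr_ge0 //.
  by move: l_le; rewrite floor_ge_int.
have c_gt0 n : (N <= n)%N -> 0 < c n.
  by move=> Nn; rewrite divr_gt0 ?exprn_gt0 // ltr0n pN_gt0.
(* Since [p n >= 1], the growth condition yields [p n.+1 >= 2 * l * p n]. *)
have c_half n : (N <= n)%N -> c n.+1 <= c n / 2.
  move=> Nn; rewrite /c exprSr -!mulrA ler_pM2l ?exprn_gt0 // -invfM.
  rewrite ler_pdivrMr ?ltr0n ?pN_gt0 ?leqW // mulrC.
  rewrite ler_pdivlMr ?mulr_gt0 ?ltr0n ?pN_gt0 // -!natrM ler_nat.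
  by rewrite (leq_trans _ (growth n Nn)) // !leq_pmul2l ?pN_gt0 // ltnS pN_gt0.
have c_dec n : (N <= n)%N -> c n.+1 <= c n.
  by move=> Nn; have := c_half n Nn; have := c_gt0 n Nn; lra.
have norm_u n : (N <= n)%N -> `|u n| = c n.
  by move=> Nn; rewrite normrM normrX normrN1 expr1n mul1r gtr0_norm // c_gt0.
have cvgL : (fun N => \sum_(1 <= n < N) u n) @ \oo --> L.
  suff : cvgn (fun N => \sum_(1 <= n < N) u n) by [].
  rewrite (is_cvg_series_restrict 1); apply: (@is_cvg_series_halving _ _ N) => k Nk.
  by rewrite !norm_u ?c_half // leqW.
split=> //; rewrite /irrational /= => -[q _ qL].
(* Dividing by [(-1) ^+ n] is multiplying by it. *)
pose s n : R := (-1) ^+ n * (L - \sum_(1 <= k < n) u k) / l%:R ^+ n.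
have s_rec n : (N <= n)%N -> s n = (p n)%:R^-1 - l%:R * s n.+1.
  move=> Nn; rewrite /s big_nat_recr /=; last by move: Nn; rewrite geq_max => /andP[].
  have p_neq0 : (p n)%:R != 0 :> R by rewrite pnatr_eq0 -lt0n pN_gt0.
  rewrite !exprS opprD addrA; apply: signed_tail_rec => //.
  - by rewrite expf_neq0 // gt_eqF.
  - by rewrite gt_eqF.
  - by rewrite -expr2 sqrr_sign.
have s_ge0 n : (N <= n)%N -> 0 <= s n.
  move=> Nn; rewrite divr_ge0 ?exprn_ge0 //.
  (* Nonnegativity is inherited in the limit from the finite alternating sums. *)
  have tail_cvg : (fun m => (-1) ^+ n *
      (\sum_(1 <= k < m) u k - \sum_(1 <= k < n) u k)) @ \oo -->
      (-1) ^+ n * (L - \sum_(1 <= k < n) u k).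
    by apply: cvgMl_tmp; apply: cvgB => //; apply: cvg_cst.
  apply: (cvgr_to_ge tail_cvg).
  exists n => // m /= nm.
  have n1 : (1 <= n)%N by move: Nn; rewrite geq_max => /andP[].
  rewrite (big_cat_nat n1 nm) /= addrAC subrr add0r.
  have c_ge0 k : (N <= k)%N -> 0 <= c k by move=> /c_gt0/ltW.
  have /andP[+ _] := alternating_sum_bounds _ _ _ c_ge0 c_dec (m - n)%N n Nn.
  have -> : \sum_(n <= k < m) u k = \sum_(0 + n <= k < m) u k by rewrite add0n.
  rewrite big_addn big_mkord mulr_sumr.
  congr (0 <= _); apply: eq_bigr => i _.
  by rewrite /u addnC exprD -[in RHS]mulrA [RHS]mulrCA signrMK.
(* The rational counterpart of [s N], with [q] in place of [L]; its image under [ratr] contradicts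
   the descent. *)
pose qs := (-1) ^+ N * (q - \sum_(1 <= k < N) ((-1) ^+ k * (l%:R ^+ k / (p k)%:R))) / l%:R ^+ N.
apply: (@descent_irrational R p l N s l_ge1 pN_gt0 growth s_rec s_ge0 N qs (leqnn N)).
rewrite /s /qs -qL fmorph_div rmorphM rmorphXn rmorphN1 rmorphB rmorph_sum /=.
rewrite rmorphXn /= ratr_nat; congr (_ * (_ - _) / _).
apply: eq_bigr => k _.
by rewrite rmorphM rmorphXn rmorphN1 fmorph_div rmorphXn /= !ratr_nat.
Qed.
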